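(* Let $m\ge1$, let $q^{[0]}$ and $f_1^{[0]},\ldots,f_m^{[0]}$ be real-valued $C^\infty$ functions on $\mathbb{R}$, and let $\lambda_1<\cdots<\lambda_m$ be real numbers such that $f_1^{[0]},\ldots,f_m^{[0]}$ are positive on $\mathbb{R}$ and satisfy $$(f_j^{[0]})''=(q^{[0]}+\lambda_j)f_j^{[0]},\qquad 1\le j\le m.$$ Let $0\le\alpha_1<\cdots<\alpha_m$ be real numbers. Let the Darboux transforms $q^{[r]}$ and $f_j^{[r]}$ ($j>r$) be defined stage by stage as described in the context. Assume that, whenever a stage $r$ ($0\le r\le m-1$) is reached: (i) $q^{[r]}$ and the remaining functions $f_j^{[r]}$, $j>r$, are $C^\infty$ on $\mathbb{R}$ and $$(f_j^{[r]})''=(q^{[r]}+\lambda_j)f_j^{[r]},\qquad j>r;$$ (ii) for every $j>r$ there is a constant $C_{r,j}>0$ such that $$f_j^{[r]}(y)=C_{r,j}e^{\alpha_j y}(1+o(1)),\qquad y\to-\infty;$$ (iii) for every $j>r$, $$(f_j^{[r]})'(y)-\alpha_j f_j^{[r]}(y)=o(e^{\alpha_j y}),\qquad y\to-\infty.$$ Then all stages $r=0,1,\ldots,m-1$ are reached, all Darboux pivots $f_{r+1}^{[r]}$ ($0\le r\le m-1$) are positive on $\mathbb{R}$, and $$W(f_1^{[0]},\ldots,f_k^{[0]})(y)>0\qquad\text{for all } 1\le k\le m \text{ and } y\in\mathbb{R}.$$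
   Context: Darboux transforms stage by stage: stage $0$ is reached and consists of $q^{[0]}$ and $f_1^{[0]},\ldots,f_m^{[0]}$. If stage $r$ is reached, consisting of $q^{[r]}$ and the remaining functions $f_j^{[r]}$ with $r<j\le m$, its pivot is $f_{r+1}^{[r]}$. Whenever the pivot $f_{r+1}^{[r]}$ has no zero on $\mathbb{R}$, stage $r+1$ is reached and is defined by $$q^{[r+1]}=q^{[r]}-2(\log f_{r+1}^{[r]})'',$$ and, for $j>r+1$, $$f_j^{[r+1]}=\left(\frac{d}{dy}-\frac{(f_{r+1}^{[r]})'}{f_{r+1}^{[r]}}\right)f_j^{[r]}.$$ (For a nowhere vanishing function $u$ on $\mathbb{R}$, $(\log u)''$ means $(u'/u)'$.) The Wronskian of $f_1,\ldots,f_k$ is $W(f_1,\ldots,f_k)=\det[f_j^{(i-1)}]_{i,j=1}^k$, where $f^{(i-1)}$ denotes the $(i-1)$-st derivative. *)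

(* Defs.v *)
From HB Require Import structures.
From mathcomp Require Import all_boot all_order all_algebra.
From mathcomp Require Import all_classical all_reals all_analysis.

Set Implicit Arguments.
Unset Strict Implicit.
Unset Printing Implicit Defensive.

Import Order.TTheory GRing.Theory Num.Theory.
Import numFieldNormedType.Exports.

Local Open Scope ring_scope.
Local Open Scope classical_set_scope.

(* Families f_1, ..., f_m are functions [nat -> R -> R] indexed from 1; only
   the indices 1 <= j <= m are meaningful. *)

Definition smooth (R : realType) (f : R -> R) : Prop :=
  forall (n : nat) (x : R), derivable (derive1n n f) x 1.

Definition wronskian (R : realType) (k : nat) (g : 'I_k -> R -> R) (y : R) : R :=
  \det (\matrix_(i < k, j < k) derive1n i (g j) y).

(* (log u)'' := (u' / u)', for u without zeros *)
Definition dlog (R : realType) (u : R -> R) : R -> R := fun y => derive1 u y / u y.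

Definition darboux_potential (R : realType) (u q : R -> R) : R -> R :=
  fun y => q y - 2 * derive1 (dlog u) y.

Definition darboux_fun (R : realType) (u f : R -> R) : R -> R :=
  fun y => derive1 f y - dlog u y * f y.

(* The pair (q^[r], (f_j^[r])_j).  As division is total, this is defined for
   all r and j, but it is a genuine Darboux transform only when stage r
   is [reached], and then only for the remaining indices r < j <= m. *)
Fixpoint darboux (R : realType) (q0 : R -> R) (f0 : nat -> R -> R) (r : nat)
    : (R -> R) * (nat -> R -> R) :=
  if r is r'.+1 then
    let: (q, f) := darboux q0 f0 r' in
    (darboux_potential (f r'.+1) q, fun j => darboux_fun (f r'.+1) (f j))
  else (q0, f0).

Definition darboux_q (R : realType) (q0 : R -> R) (f0 : nat -> R -> R) (r : nat)
  : R -> R := (darboux q0 f0 r).1.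

Definition darboux_f (R : realType) (q0 : R -> R) (f0 : nat -> R -> R)
  (r j : nat) : R -> R := (darboux q0 f0 r).2 j.

Definition pivot (R : realType) (q0 : R -> R) (f0 : nat -> R -> R) (r : nat)
  : R -> R := darboux_f q0 f0 r r.+1.

Inductive reached (R : realType) (m : nat) (q0 : R -> R) (f0 : nat -> R -> R)
    : nat -> Prop :=
| reached0 : reached m q0 f0 0
| reachedS r : reached m q0 f0 r -> (r < m)%N ->
    (forall y, pivot q0 f0 r y != 0) -> reached m q0 f0 r.+1.

(* lets the Landau notations be used at -oo *)
Canonical ninfty_filter_on (R : numFieldType) : filter_on R :=
  FilterType (ninfty_nbhs R) (@proper_ninfty_nbhs R).

(* Main.v *)
(* With u the pivot of stage r and v a remaining function,
   W = u v' - u' v satisfies W' = (lambda_j - lambda_{r+1}) u v > 0 and tends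
   to 0 at -oo, so W > 0 and the Darboux transform W / u of v is positive;
   this propagates positivity from one stage to the next. The Wronskians are
   products of pivots, by Crum's identity
   W(u, g_1, ..., g_n) = u * W(D g_1, ..., D g_n) with D g = g' - (u'/u) g. *)
Require Import Defs.
From HB Require Import structures.
From mathcomp Require Import all_boot all_order all_algebra.
From mathcomp Require Import all_classical all_reals all_analysis.
From mathcomp Require Import ring lra.

Set Implicit Arguments.
Unset Strict Implicit.
Unset Printing Implicit Defensive.

Import Order.TTheory GRing.Theory Num.Theory.
Import numFieldNormedType.Exports.

Local Open Scope ring_scope.
Local Open Scope classical_set_scope.

(** * Smoothness of sums, products and quotients *)

Section smoothness.
Context {R : realType}.
Implicit Types (f g u : R -> R) (n : nat).

(** A finite order gives an index for induction: the derivative of a product or an inverse is built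
    from functions differentiable to one order less. Since the orders up to [n] are themselves
    derivable, this means [n.+1] times differentiable. *)
Definition smooth_upto n f : Prop :=
  forall k, (k <= n)%N -> forall x, derivable (derive1n k f) x 1.

Lemma smooth_uptoP f : smooth f <-> forall n, smooth_upto n f.
Proof.
by split=> [sf n k _ x|sf n x]; [exact: sf|exact: (sf n n (leqnn n))].
Qed.

Lemma smooth_upto0 f : smooth_upto 0 f <-> forall x, derivable f x 1.
Proof.
split=> [sf x|df k]; first exact: (sf 0%N).
by rewrite leqn0 => /eqP ->.
Qed.

Lemma smooth_uptoS n f :
  smooth_upto n.+1 f <->
  (forall x, derivable f x 1) /\ smooth_upto n (derive1 f).
Proof.
split=> [sf|[df sf] [_ x|k kn x]].
- split=> [x|k kn x]; first exact: (sf 0%N).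
  by rewrite -derive1Sn; exact: sf.
- exact: df.
- by rewrite derive1Sn; exact: sf.
Qed.

Lemma smooth_uptoW n f : smooth_upto n.+1 f -> smooth_upto n f.
Proof. by move=> sf k kn; apply: sf; exact: leqW. Qed.

Lemma smooth_derivable f : smooth f -> forall x, derivable f x 1.
Proof. by move=> sf x; exact: (sf 0%N). Qed.

Lemma smooth_derive1 f : smooth f -> smooth (derive1 f).
Proof. by move=> sf n x; rewrite -derive1Sn; exact: sf. Qed.

Lemma derive1D_fun f g :
  (forall x, derivable f x 1) -> (forall x, derivable g x 1) ->
  derive1 (fun x => f x + g x) = (fun x => derive1 f x + derive1 g x).
Proof. by move=> df dg; apply/funext => x; rewrite !derive1E deriveD. Qed.

Lemma derive1N_fun f : (forall x, derivable f x 1) ->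
  derive1 (fun x => - f x) = (fun x => - derive1 f x).
Proof. by move=> df; apply/funext => x; rewrite !derive1E deriveN. Qed.

Lemma derive1M_fun f g :
  (forall x, derivable f x 1) -> (forall x, derivable g x 1) ->
  derive1 (fun x => f x * g x) =
  (fun x => derive1 f x * g x + f x * derive1 g x).
Proof.
move=> df dg; apply/funext => x; rewrite !derive1E deriveM//.
by rewrite addrC [_ *: 'D_1 f x]mulrC.
Qed.

Lemma derive1V_fun u :
  (forall x, u x != 0) -> (forall x, derivable u x 1) ->
  derive1 (fun x => (u x)^-1) = (fun x => - derive1 u x * ((u x)^-1 * (u x)^-1)).
Proof.
move=> u0 du; apply/funext => x; rewrite !derive1E deriveV//.
by rewrite -[LHS]/(_ * _) -exprVn expr2 !mulNr mulrC.
Qed.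

Lemma smooth_uptoD n f g :
  smooth_upto n f -> smooth_upto n g -> smooth_upto n (fun x => f x + g x).
Proof.
elim: n f g => [|n IHn] f g.
  by move=> /smooth_upto0 df /smooth_upto0 dg; apply/smooth_upto0 => x; exact: derivableD.
move=> /smooth_uptoS[df sf] /smooth_uptoS[dg sg]; apply/smooth_uptoS; split.
  by move=> x; exact: derivableD.
by rewrite derive1D_fun//; exact: IHn.
Qed.

Lemma smooth_uptoN n f : smooth_upto n f -> smooth_upto n (fun x => - f x).
Proof.
elim: n f => [|n IHn] f.
  by move=> /smooth_upto0 df; apply/smooth_upto0 => x; exact: derivableN.
move=> /smooth_uptoS[df sf]; apply/smooth_uptoS; split.
  by move=> x; exact: derivableN.
by rewrite derive1N_fun//; exact: IHn.
Qed.

Lemma smooth_uptoM n f g :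
  smooth_upto n f -> smooth_upto n g -> smooth_upto n (fun x => f x * g x).
Proof.
elim: n f g => [|n IHn] f g.
  by move=> /smooth_upto0 df /smooth_upto0 dg; apply/smooth_upto0 => x; exact: derivableM.
move=> sf sg; move: (sf) (sg) => /smooth_uptoS[df sf'] /smooth_uptoS[dg sg'].
apply/smooth_uptoS; split; first by move=> x; exact: derivableM.
have /IHn fg' := smooth_uptoW sf; have /IHn f'g := sf'.
rewrite derive1M_fun//; apply: smooth_uptoD; last exact: fg'.
exact/f'g/smooth_uptoW.
Qed.

(** Since [(1/u)' = - u' (1/u)^2], order [n.+1] for [1/u] reduces to products of [u'] and [1/u] at
    order [n], the latter being the induction hypothesis. *)
Lemma smooth_uptoV n u : (forall x, u x != 0) ->
  smooth_upto n u -> smooth_upto n (fun x => (u x)^-1).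
Proof.
move=> u0; elim: n => [|n IHn].
  by move=> /smooth_upto0 du; apply/smooth_upto0 => x; exact: derivableV.
move=> su; have suV := IHn (smooth_uptoW su).
move: su => /smooth_uptoS[du su']; apply/smooth_uptoS; split.
  by move=> x; exact: derivableV.
rewrite derive1V_fun//; apply: smooth_uptoM; first exact: smooth_uptoN.
exact: smooth_uptoM.
Qed.

Lemma smooth_cst (c : R) : smooth (fun=> c).
Proof.
suff H n (d : R) : smooth_upto n (fun=> d) by apply/smooth_uptoP => n; exact: H.
elim: n d => [|n IHn] d; first by apply/smooth_upto0 => x; exact: derivable_cst.
apply/smooth_uptoS; split=> [x|]; first exact: derivable_cst.
suff -> : derive1 (fun=> d : R) = (fun=> 0) by exact: IHn.
by apply/funext => x; rewrite derive1_cst.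
Qed.

Lemma smoothD f g : smooth f -> smooth g -> smooth (fun x => f x + g x).
Proof.
move=> /smooth_uptoP sf /smooth_uptoP sg; apply/smooth_uptoP => n.
exact: smooth_uptoD.
Qed.

Lemma smooth_dlog u : (forall x, u x != 0) -> smooth u -> smooth (dlog u).
Proof.
move=> u0 /smooth_uptoP su; apply/smooth_uptoP => n.
apply: smooth_uptoM; last exact: smooth_uptoV.
by have /smooth_uptoS[] := su n.+1.
Qed.

Lemma smoothN f : smooth f -> smooth (fun x => - f x).
Proof. by move=> /smooth_uptoP sf; apply/smooth_uptoP => n; exact: smooth_uptoN. Qed.

Lemma derive1n_cst0 n : derive1n n (fun=> 0 : R) = (fun=> 0).
Proof.
elim: n => // n IHn; rewrite derive1nS IHn.
by apply/funext => x; rewrite derive1_cst.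
Qed.

End smoothness.

(** * Crum's identity: the first function factors out of the Wronskian *)

Section wronskian_reduction.
Context {R : realType}.
Implicit Types (f u : R -> R).

(** The coefficients [c] are chosen before [f], so the formula is one row operation valid in every
    column of a Wronskian matrix. Their smoothness lets the induction differentiate the formula
    again. *)
Lemma derive1n_darboux_fun u i : (forall x, u x != 0) -> smooth u ->
  exists2 c : nat -> R -> R, forall l, smooth (c l) &
    forall f, smooth f -> forall y,
      derive1n i (darboux_fun u f) y =
      derive1n i.+1 f y + \sum_(l < i.+1) c l y * derive1n l f y.
Proof.
move=> u0 su; elim: i => [|i [c sc IHi]].
  exists (fun _ y => - dlog u y) => [_|f sf y]; first exact/smoothN/smooth_dlog.
  by rewrite big_ord1 derive1n1 /= mulNr.
(* The product rule turns [c_l f^(l)] into [c_l' f^(l) + c_l f^(l+1)]. The guard discards [c i.+1],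
   which is absent from the sum being differentiated. *)
exists (fun l y => (if (l <= i)%N then derive1 (c l) y else 0) +
                   (if l is l'.+1 then c l' y else 0)).
  move=> l; apply: smoothD.
    by case: (l <= i)%N; [exact: smooth_derive1 | exact: smooth_cst].
  by case: l => [|l]; [exact: smooth_cst | exact: sc].
move=> f sf y; rewrite derive1nS.
have -> : derive1n i (darboux_fun u f) = (fun x => derive1n i.+1 f x +
    (\sum_(l < i.+1) (fun z => c l z * derive1n l f z)) x).
  by apply/funext => x; rewrite IHi// fct_sumE.
have dterm (l : 'I_i.+1) x :
    derivable (fun z => c l z * derive1n l f z) x 1.
  by apply: derivableM; [exact/smooth_derivable | exact: sf].
rewrite derive1D_fun; [|exact: sf|by move=> x; exact: derivable_sum].
rewrite -derive1nS; congr (_ + _).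
rewrite derive1E derive_sum//.
under eq_bigr => l _.
  rewrite -derive1E derive1M_fun; [|exact/smooth_derivable|exact: sf].
  rewrite -derive1nS; over.
rewrite big_split/=; under [RHS]eq_bigr do rewrite mulrDl.
rewrite [RHS]big_split/=; congr (_ + _).
  rewrite [RHS]big_ord_recr/= ltnn mul0r addr0.
  by apply: eq_bigr => l _; rewrite -ltnS ltn_ord.
by rewrite [RHS]big_ord_recl/= mul0r add0r.
Qed.

(** Row operations of determinant 1 replace derivatives of each [g j] by derivatives of its Darboux
    transform. The transform of [u] itself is 0, so the first column becomes [(u, 0, ..., 0)], and
    expanding along it gives the identity. *)
Lemma wronskian_darboux n (g : 'I_n.+1 -> R -> R) y :
  (forall j, smooth (g j)) -> (forall x, g ord0 x != 0) ->
  wronskian g y = g ord0 y *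
    wronskian (fun j : 'I_n => darboux_fun (g ord0) (g (lift ord0 j))) y.
Proof.
set u := g ord0 => sg u0.
have /choice[c cE] (i : nat) : exists c : nat -> R, forall f, smooth f ->
    derive1n i (darboux_fun u f) y =
    derive1n i.+1 f y + \sum_(l < i.+1) c l * derive1n l f y.
  have [c _ cE] := derive1n_darboux_fun i u0 (sg ord0).
  by exists (fun l => c l y) => f sf; exact: cE.
pose M := \matrix_(i < n.+1, j < n.+1) derive1n i (g j) y.
(* Left multiplication by the unitriangular [L] replaces row [i.+1] of the
   Wronskian matrix by the [i]-th derivatives of the Darboux transforms. *)
pose L := \matrix_(i < n.+1, l < n.+1)
  (if l == i then 1 else if (l < i)%N then c i.-1 l else 0).
have detL : \det L = 1.
  rewrite det_trig; first by apply: big1 => i _; rewrite mxE eqxx.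
  apply/is_trig_mxP => i j ij; rewrite mxE.
  by rewrite -val_eqE/= gtn_eqF// ltnNge ltnW.
(* In row 0 the value [i.-1 = 0] is harmless, because the sum is empty. *)
have LME i j : (L *m M) i j =
    derive1n i (g j) y + \sum_(l < i) c i.-1 l * derive1n l (g j) y.
  rewrite mxE (bigD1 i)//= !mxE eqxx mul1r; congr (_ + _).
  rewrite (big_ord_widen n.+1 (fun l => c i.-1 l * derive1n l (g j) y)) 1?ltnW//.
  rewrite big_mkcond [RHS]big_mkcond/=; apply: eq_bigr => l _.
  rewrite !mxE -val_eqE/=; case: ltngtP => _ //=; by rewrite mul0r.
have LM0 j : (L *m M) ord0 j = g j y by rewrite LME big_ord0 addr0.
have LMS (i : 'I_n) j :
    (L *m M) (lift ord0 i) j = derive1n i (darboux_fun u (g j)) y.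
  by rewrite LME cE.
have Du : darboux_fun u u = (fun=> 0).
  by apply/funext => x; rewrite /darboux_fun /dlog divfK ?subrr.
have -> : wronskian g y = \det (L *m M) by rewrite det_mulmx detL mul1r.
rewrite (expand_det_col _ ord0) big_ord_recl LM0 [X in _ + X]big1 ?addr0; last first.
  by move=> i _; rewrite LMS Du derive1n_cst0 mul0r.
rewrite /cofactor expr0 mul1r; congr (_ * \det _).
by apply/matrixP => i j; rewrite !mxE -LMS mxE.
Qed.

End wronskian_reduction.

(** * Positivity of [u v' - u' v] from its decay at -oo *)

Section positivity.
Context {R : realType}.
Implicit Types (f u v W : R -> R).

Lemma derive1_gt0_lt W : (forall x, derivable W x 1) ->
  (forall x, 0 < derive1 W x) -> {homo W : x y / x < y}.
Proof.
move=> dW W'0 x y xy.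
apply: (@gtr0_derive1_lt_cc _ W x y) => //; rewrite ?in_itv/= ?lexx ?ltW//.
apply: continuous_subspaceT => z.
exact/differentiable_continuous/derivable1_diffP.
Qed.

(** The bound forces [W] to tend to 0 at -oo. A negative value [W y] would keep [|W z| > - W y] for
    all [z < y], against this decay. *)
Lemma incr_expR_bound_gt0 W K c : 0 < K -> 0 < c ->
  {homo W : x y / x < y} ->
  (\forall z \near -oo_ R, `|W z| <= K * expR (c * z)) -> forall y, 0 < W y.
Proof.
move=> K0 c0 incrW boundW.
(* Strict monotonicity upgrades nonnegativity at [y - 1] to positivity at [y]. *)
suff W_ge0 y : 0 <= W y.
  by move=> y; apply: (le_lt_trans (W_ge0 (y - 1))); apply: incrW; lra.
rewrite leNgt; apply/negP => Wy.
have KW0 : 0 < - W y / K by rewrite divr_gt0// oppr_gt0.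
near (-oo_ R) => z.
have zy : z < y by near: z; apply: nbhs_ninfty_lt; exact: num_real.
(* This is the threshold below which [K * expR (c * z) < - W y]. *)
have zln : z < ln (- W y / K) / c.
  by near: z; apply: nbhs_ninfty_lt; exact: num_real.
have : `|W z| <= K * expR (c * z) by near: z.
apply/negP; rewrite -ltNge.
have Wzy := incrW _ _ zy.
rewrite ltr0_norm ?(lt_trans Wzy)//.
apply: (@lt_trans _ _ (- W y)); last by rewrite ltrN2.
rewrite mulrC -ltr_pdivlMr// -[ltRHS]lnK ?posrE// ltr_expR mulrC.
by rewrite -ltr_pdivlMr.
Unshelve. all: by end_near. Qed.

Lemma expR_bound_asymp f a C (eps : R -> R) : 0 < C ->
  eps =o_ (-oo_ R) (fun=> 1 : R) ->
  (\forall y \near -oo_ R, f y = C * expR (a * y) * (1 + eps y)) ->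
  (fun y => derive1 f y - a * f y) =o_ (-oo_ R) (fun y => expR (a * y)) ->
  exists2 K, 0 < K & \forall y \near -oo_ R,
    `|f y| <= K * expR (a * y) /\ `|derive1 f y| <= K * expR (a * y).
Proof.
move=> C0 /eqoP eps0 fE /eqoP df.
(* Once [|eps| <= 1], [2 * C] serves for [f]; then [|f'| <= |f' - a f| + |a f|] gives
   [1 + |a| * (2 * C)] for the derivative. The sum serves for both. *)
exists (2 * C + (1 + `|a| * (2 * C))).
  by rewrite addr_gt0 ?mulr_gt0// ltr_pwDl// mulr_ge0// mulr_ge0// ltW.
have {}eps0 := eps0 1 ltr01; have {}df := df 1 ltr01.
near=> y.
have fy : `|f y| <= 2 * C * expR (a * y).
  have -> : f y = C * expR (a * y) * (1 + eps y) by near: y.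
  have epsy : `|eps y| <= 1 * `|1 : R| by near: y.
  have CE0 : 0 < C * expR (a * y) by rewrite mulr_gt0// expR_gt0.
  rewrite normrM (gtr0_norm CE0) mulrC -(mulrA 2) ler_pM2r//.
  rewrite mul1r normr1 in epsy.
  by rewrite (le_trans (ler_normD _ _))// normr1; lra.
have dfy : `|derive1 f y - a * f y| <= 1 * `|expR (a * y)| by near: y.
rewrite mul1r (ger0_norm (expR_ge0 _)) in dfy.
have E0 := expR_gt0 (a * y); set E := expR _ in fy dfy E0 *.
have a0 : 0 <= `|a| by [].
have af : `|a * f y| <= `|a| * (2 * C) * E by rewrite normrM -mulrA ler_wpM2l.
have aCE : 0 <= `|a| * (2 * C) * E.
  by apply: le_trans af; exact: normr_ge0.
have CE : 0 < 2 * C * E by rewrite !mulr_gt0.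
split; first by rewrite mulrDl mulrDl mul1r; lra.
have : `|derive1 f y| <= `|derive1 f y - a * f y| + `|a * f y|.
  by rewrite -{1}(subrK (a * f y) (derive1 f y)) ler_normD.
by move=> tri; rewrite mulrDl mulrDl mul1r; lra.
Unshelve. all: by end_near. Qed.

(** The potential cancels in [W' = u v'' - u'' v], leaving a positive function. Each product in [W]
    decays like [expR ((a + b) * y)], so only the sum of the exponents has to be positive, which
    admits a first exponent equal to 0. *)
Lemma wronskian2_gt0 u v (q : R -> R) (lu lv a b Ku Kv : R) :
  0 < a + b -> lu < lv -> 0 < Ku -> 0 < Kv ->
  (forall y, 0 < u y) -> (forall y, 0 < v y) ->
  smooth u -> smooth v ->
  (forall y, derive1n 2 u y = (q y + lu) * u y) ->
  (forall y, derive1n 2 v y = (q y + lv) * v y) ->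
  (\forall y \near -oo_ R,
    `|u y| <= Ku * expR (a * y) /\ `|derive1 u y| <= Ku * expR (a * y)) ->
  (\forall y \near -oo_ R,
    `|v y| <= Kv * expR (b * y) /\ `|derive1 v y| <= Kv * expR (b * y)) ->
  forall y, 0 < u y * derive1 v y - derive1 u y * v y.
Proof.
move=> ab luv Ku0 Kv0 u0 v0 su sv odeu odev bu bv.
set W := fun y => u y * derive1 v y - derive1 u y * v y.
have is_W (x : R) : is_derive x (1 : R) W ((lv - lu) * (u x * v x)).
  have du : is_derive x (1 : R) u (derive1 u x).
    by rewrite derive1E; apply: DeriveDef => //; exact: (su 0%N).
  have dv : is_derive x (1 : R) v (derive1 v x).
    by rewrite derive1E; apply: DeriveDef => //; exact: (sv 0%N).
  have ddu : is_derive x (1 : R) (derive1 u) (derive1n 2 u x).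
    by rewrite derive1nS derive1E; apply: DeriveDef => //; exact: (su 1%N).
  have ddv : is_derive x (1 : R) (derive1 v) (derive1n 2 v x).
    by rewrite derive1nS derive1E; apply: DeriveDef => //; exact: (sv 1%N).
  (* Written with operations on functions, so that the product rule can be inferred. *)
  have -> : W = u * derive1 v - derive1 u * v by [].
  apply: is_derive_eq; rewrite odeu odev /GRing.scale/=; ring.
apply: (@incr_expR_bound_gt0 W (2 * (Ku * Kv)) (a + b)) => //.
- by rewrite !mulr_gt0.
- apply: derive1_gt0_lt => x; first exact: ex_derive.
  by rewrite derive1E derive_val mulr_gt0 ?subr_gt0 ?mulr_gt0.
- near=> y.
  have [uy u'y] : `|u y| <= Ku * expR (a * y) /\
    `|derive1 u y| <= Ku * expR (a * y) by near: y.
  have [vy v'y] : `|v y| <= Kv * expR (b * y) /\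
    `|derive1 v y| <= Kv * expR (b * y) by near: y.
  rewrite (mulrDl a b y) expRD.
  have -> : 2 * (Ku * Kv) * (expR (a * y) * expR (b * y)) =
    Ku * expR (a * y) * (Kv * expR (b * y)) +
    Ku * expR (a * y) * (Kv * expR (b * y)) by ring.
  by rewrite (le_trans (ler_normB _ _))// !normrM lerD// ler_pM.
Unshelve. all: by end_near. Qed.

End positivity.

(** * Induction on the stages and on the size of the Wronskian *)

Lemma darboux_fS (R : realType) (q0 : R -> R) (f0 : nat -> R -> R) (r j : nat) :
  darboux_f q0 f0 r.+1 j = darboux_fun (pivot q0 f0 r) (darboux_f q0 f0 r j).
Proof. by rewrite /pivot /darboux_f /=; case: (darboux q0 f0 r). Qed.

Theorem proposition3p1 (R : realType) (m : nat) (m_ge1 : (1 <= m)%N)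
  (q0 : R -> R) (f0 : nat -> R -> R) (lambda alpha : nat -> R)
  (q0_smooth : smooth q0)
  (f0_smooth : forall j, (1 <= j <= m)%N -> smooth (f0 j))
  (lambda_incr : forall i j, (1 <= i)%N -> (i < j)%N -> (j <= m)%N ->
    lambda i < lambda j)
  (f0_gt0 : forall j, (1 <= j <= m)%N -> forall y, 0 < f0 j y)
  (f0_ode : forall j, (1 <= j <= m)%N -> forall y,
    derive1n 2 (f0 j) y = (q0 y + lambda j) * f0 j y)
  (alpha1_ge0 : 0 <= alpha 1%N)
  (alpha_incr : forall i j, (1 <= i)%N -> (i < j)%N -> (j <= m)%N ->
    alpha i < alpha j)
  (stage_smooth_ode : forall r, (r < m)%N -> reached m q0 f0 r ->
    smooth (darboux_q q0 f0 r) /\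
    forall j, (r < j <= m)%N ->
      smooth (darboux_f q0 f0 r j) /\
      forall y, derive1n 2 (darboux_f q0 f0 r j) y
                = (darboux_q q0 f0 r y + lambda j) * darboux_f q0 f0 r j y)
  (stage_asymp : forall r, (r < m)%N -> reached m q0 f0 r ->
    forall j, (r < j <= m)%N -> exists2 C : R, 0 < C &
      exists2 eps : R -> R, eps =o_ (-oo_ R) (fun=> 1 : R) &
        \forall y \near -oo_ R,
          darboux_f q0 f0 r j y = C * expR (alpha j * y) * (1 + eps y))
  (stage_asymp_deriv : forall r, (r < m)%N -> reached m q0 f0 r ->
    forall j, (r < j <= m)%N ->
      (fun y => derive1 (darboux_f q0 f0 r j) y - alpha j * darboux_f q0 f0 r j y)
        =o_ (-oo_ R) (fun y => expR (alpha j * y))) :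
  [/\ forall r, (r < m)%N -> reached m q0 f0 r,
      forall r, (r < m)%N -> forall y, 0 < pivot q0 f0 r y
    & forall k, (1 <= k <= m)%N -> forall y,
        0 < wronskian (fun j : 'I_k => f0 j.+1) y].
Proof.
have alpha_ge0 j : (1 <= j <= m)%N -> 0 <= alpha j.
  case/andP => j1 jm; case: (ltngtP j 1) j1 => // [j1 _|-> //].
  by apply: (le_trans alpha1_ge0); apply/ltW/alpha_incr.
have bounds r j : (r < m)%N -> reached m q0 f0 r -> (r < j <= m)%N ->
    exists2 K, 0 < K & \forall y \near -oo_ R,
      `|darboux_f q0 f0 r j y| <= K * expR (alpha j * y) /\
      `|derive1 (darboux_f q0 f0 r j) y| <= K * expR (alpha j * y).
  move=> rm rr rj; have [C C0 [eps eps0 fE]] := stage_asymp r rm rr j rj.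
  exact: (expR_bound_asymp C0 eps0 fE (stage_asymp_deriv r rm rr j rj)).
(* Both claims go through one induction: positivity makes the pivot nonzero, hence the next stage
   reached, while reaching stage [r] supplies the equations and asymptotics that give positivity at
   stage [r.+1]. *)
have stages r : (r < m)%N -> reached m q0 f0 r /\
    forall j, (r < j <= m)%N -> forall y, 0 < darboux_f q0 f0 r j y.
  elim: r => [|r IHr] rm; first by split; [exact: reached0 | exact: f0_gt0].
  have rm' := ltnW rm; have [rr f_gt0] := IHr rm'.
  have r1 : (r < r.+1 <= m)%N by rewrite leqnn.
  have piv_gt0 y : 0 < pivot q0 f0 r y := f_gt0 _ r1 y.
  split; first by apply: reachedS => // y; rewrite gt_eqF.
  move=> j /andP[rj jm] y; have rjm : (r < j <= m)%N by rewrite ltnW.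
  have [_ /[dup] /(_ _ r1)[su odeu] /(_ _ rjm)[sv odev]] :=
    stage_smooth_ode r rm' rr.
  have [Ku Ku0 bu] := bounds r r.+1 rm' rr r1.
  have [Kv Kv0 bv] := bounds r j rm' rr rjm.
  rewrite darboux_fS /darboux_fun /dlog.
  have -> (a b : R) : b - a / pivot q0 f0 r y * darboux_f q0 f0 r j y =
      (pivot q0 f0 r y * b - a * darboux_f q0 f0 r j y) / pivot q0 f0 r y.
    by field; rewrite gt_eqF.
  rewrite divr_gt0//.
  apply: (wronskian2_gt0 _ _ Ku0 Kv0 _ _ su sv odeu odev bu bv) => //.
  (* Even if [alpha r.+1 = 0], the strict increase makes [alpha j] positive. *)
  - by rewrite ltr_wpDl ?alpha_ge0// (le_lt_trans (alpha_ge0 r.+1 _)) ?alpha_incr.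
  - exact: lambda_incr.
  - exact: f_gt0.
have pivot_gt0 r : (r < m)%N -> forall y, 0 < pivot q0 f0 r y.
  by move=> rm; apply: (stages r rm).2; rewrite leqnn.
split=> [r rm| //|k /andP[_ km] y]; first exact: (stages r rm).1.
(* Crum's identity trades one function for one stage, so the claim is generalized to the first [n]
   remaining functions of any stage [r]; the empty Wronskian is 1. *)
suff W_gt0 n r : (r + n <= m)%N ->
    0 < wronskian (fun j : 'I_n => darboux_f q0 f0 r (r + j).+1) y.
  exact: (W_gt0 k 0%N km).
elim: n r => [|n IHn] r rnm; first by rewrite /wronskian det_mx00.
have rm : (r < m)%N by apply: leq_trans rnm; rewrite addnS ltnS leq_addr.
have [_ sf] := stage_smooth_ode r rm (stages r rm).1.
have piv : darboux_f q0 f0 r (r + @ord0 n).+1 = pivot q0 f0 r by rewrite addn0.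
rewrite wronskian_darboux; last 2 first.
- move=> j; have [|//] := sf (r + j).+1.
  by rewrite ltnS leq_addr/=; apply: leq_trans rnm; rewrite -addnS leq_add2l.
- by move=> x; rewrite piv gt_eqF// pivot_gt0.
rewrite piv mulr_gt0 ?pivot_gt0//.
(* Removing the pivot shifts indices by one: [r + j.+1 = r.+1 + j]. *)
have -> : (fun j : 'I_n => darboux_fun (pivot q0 f0 r)
    (darboux_f q0 f0 r (r + lift ord0 j).+1)) =
    (fun j : 'I_n => darboux_f q0 f0 r.+1 (r.+1 + j).+1).
  by apply/funext => j; rewrite darboux_fS addSnnS.
by apply: IHn; rewrite addSnnS.
Qed.
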